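(* Let $k$ be a positive integer, $r,n,m$ positive integers, $\overline{\alpha}_r=(\alpha_0,\dots,\alpha_{r-1})$ complex numbers, $(\overline{\alpha}_r)^n=(\alpha_0^n,\dots,\alpha_{r-1}^n)$ and $(\overline{\alpha}_r)^m=(\alpha_0^m,\dots,\alpha_{r-1}^m)$. Then for all real $x$ and all $\ell\in\mathbb{N}_0$, $$n^{\ell}\prod_{i=1}^{r}\sum_{s_i=0}^{n-1}(\alpha_{i-1})^{ms_i}M^{[0,r]}_{\ell}\left(\frac{x}{n}+\frac{\left(\sum_{i=1}^{r}s_i\right)m}{n};k;1,e,e;(\overline{\alpha}_r)^n\right)=m^{-rk+\ell}n^{rk}\prod_{i=1}^{r}\sum_{p_i=0}^{m-1}(\alpha_{i-1})^{np_i}M^{[0,r]}_{\ell}\left(\frac{x}{m}+\frac{\left(\sum_{i=1}^{r}p_i\right)n}{m};k;1,e,e;(\overline{\alpha}_r)^m\right),$$ and $$n^{\ell+r}\prod_{i=1}^{r}\sum_{s_i=0}^{n-1}(\alpha_{i-1})^{ms_i}M^{[0,r]}_{\ell+r}\left(\frac{x}{n}+\frac{\left(\sum_{i=1}^{r}s_i\right)m}{n};k;1,e,e;(\overline{\alpha}_r)^n\right)=\frac{(\ell+r)!}{\ell!}\cdot\frac{m^{-r(k-1)+\ell}n^{rk}}{2^{r}}\prod_{i=1}^{r}\sum_{p_i=0}^{m-1}(\alpha_{i-1})^{np_i}M^{[0,r]}_{\ell}\left(\frac{x}{m}+\frac{\left(\sum_{i=1}^{r}p_i\right)n}{m};k-1;1,e,e;(\overline{\alpha}_r)^m\right).$$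 (Here $\prod_i\sum_{s_i}(\cdots)^{s_i}M(\dots)$ denotes the multiple sum over all $s_1,\dots,s_r$ in the indicated range of the product of the weights times $M(\dots)$, and similarly for the $p_i$.)
   Context: For a nonnegative integer $k$, a positive integer $r$ and complex numbers $\overline{\beta}_r=(\beta_0,\dots,\beta_{r-1})$, the polynomials $M^{[0,r]}_{n}(x;k;1,e,e;\overline{\beta}_{r})$, $n\in\mathbb{N}_0$, are the Taylor coefficients at $t=0$ of $$\frac{t^{rk}2^{r(1-k)}e^{xt}}{\prod_{i=0}^{r-1}\left(\beta_{i}e^{t}-1\right)}=\sum_{n=0}^{\infty}M^{[0,r]}_{n}(x;k;1,e,e;\overline{\beta}_{r})\frac{t^{n}}{n!},$$ the parameters being assumed such that all generating functions involved are analytic in a neighbourhood of $t=0$. *)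

(* Defs.v *)
From mathcomp Require Import all_boot all_order all_algebra.
From mathcomp Require Import all_classical all_reals all_analysis.
From mathcomp Require Export complex.

Set Implicit Arguments.
Unset Strict Implicit.
Unset Printing Implicit Defensive.

Import Order.TTheory GRing.Theory Num.Theory.
Import numFieldNormedType.Exports.

Local Open Scope classical_set_scope.
Local Open Scope ring_scope.
Local Open Scope complex_scope.

Definition expC (R : realType) (z : R[i]) : R[i] :=
  (expR (complex.Re z))%:C *
    (cos (complex.Im z) +i* sin (complex.Im z)).

Definition genM (R : realType) (r k : nat) (beta : 'I_r -> R[i])
    (x t : R[i]) : R[i] :=
  t ^+ (r * k) * 2 ^ (r%:Z * (1 - k%:Z)) * expC (x * t)
    / \prod_(i < r) (beta i * expC t - 1).

(* A singularity of [f] at 0 is understood to be removed: [f] is compared with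
   the sum of the series on a punctured neighbourhood only. Here [R[i]^o] is
   [R[i]] with its usual topology. *)
Definition taylor_at0 (R : realType) (f : R[i] -> R[i]) (a : nat -> R[i]) :
    Prop :=
  \forall t \near (0 : R[i]^o)^',
    series (fun n => a n * t ^+ n / (n`!)%:R : R[i]^o) @ \oo --> (f t : R[i]^o).

Definition analytic_at0 (R : realType) (f : R[i] -> R[i]) : Prop :=
  exists a, taylor_at0 f a.

(* M^{[0,r]}_n(x;k;1,e,e;beta); the value is 0 when the generating function is
   not analytic at 0. *)
Definition polyM (R : realType) (r k : nat) (beta : 'I_r -> R[i])
    (n : nat) (x : R[i]) : R[i] :=
  xget (fun=> 0) [set a | taylor_at0 (genM k beta x) a] n.

(* Main.v *)
(** Write z_i = alpha_i e^t. Replacing t by n t in the generating function and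
    summing the geometric progressions over the s_i turns the left-hand side into
    n^(rk) t^(rk) 2^(r(1-k)) e^(xt) prod_i (z_i^(nm) - 1) / ((z_i^n - 1) (z_i^m - 1)),
    where the product is symmetric in n and m. Hence the two generating functions
    agree near 0 up to a constant factor, and up to a factor t^r when k is lowered
    by one, so the identities follow by comparing Taylor coefficients. *)

Require Import Defs.
From mathcomp Require Import all_boot all_order all_algebra.
From mathcomp Require Import all_classical all_reals all_analysis.
From mathcomp Require Import complex ring.

Import Order.TTheory GRing.Theory Num.Theory.
Import numFieldNormedType.Exports.

Local Open Scope classical_set_scope.
Local Open Scope ring_scope.
Local Open Scope complex_scope.

(** * Punctured neighbourhoods of 0 *)

Lemma near_punctured0P (K : numFieldType) (P : K -> Prop) :
  (\forall t \near (0 : K^o)^', P t) <->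
  exists2 e : K, 0 < e & forall t, t != 0 -> `|t| < e -> P t.
Proof.
split.
  move=> /nbhs_ballP[e e0 h]; exists e => // t t0 te; apply: h => //.
  by rewrite -ball_normE /= sub0r normrN.
move=> [e e0 h]; apply/nbhs_ballP; exists e => // t.
by rewrite -ball_normE /= sub0r normrN => te t0; apply: h.
Qed.

Lemma near_punctured0_scale (K : numFieldType) (c : K) (P : K -> Prop) :
  c != 0 -> (\forall t \near (0 : K^o)^', P t) ->
  \forall t \near (0 : K^o)^', P (c * t).
Proof.
move=> c0 /near_punctured0P[e e0 h]; apply/near_punctured0P.
exists (e / `|c|); first by rewrite divr_gt0 ?normr_gt0.
move=> t t0 te; apply: h; first by rewrite mulf_neq0.
by rewrite normrM mulrC -ltr_pdivlMr ?normr_gt0.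
Qed.

(** * Uniqueness of Taylor coefficients *)

(** For [q <= 1/2] the geometric sums stay below 2, since each is 1 plus [q] times the previous one.
    The bound is uniform in [n], so it can serve as a tail estimate. *)
Lemma norm_sum_geometric_le (K : numFieldType) (a : nat -> K) (M q : K) :
  (forall i, `|a i| <= M) -> 0 <= q -> q <= 2^-1 ->
  forall n, `|\sum_(i < n) a i * q ^+ i| <= 2 * M.
Proof.
move=> aM q0 q2 n.
have M0 : 0 <= M by apply: le_trans (aM 0%N).
have geo : \sum_(i < n) q ^+ i <= 2.
  elim: n => [|n IH]; first by rewrite big_ord0 ler0n.
  rewrite big_ord_recl expr0.
  under eq_bigr do rewrite exprS.
  rewrite -big_distrr /= (_ : 2 = 1 + 2^-1 * 2); last by rewrite mulVf ?pnatr_eq0.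
  by rewrite lerD2l ler_pM // sumr_ge0 // => i _; rewrite exprn_ge0.
apply: le_trans (ler_norm_sum _ _ _) _.
apply: (@le_trans _ _ (\sum_(i < n) M * q ^+ i)).
  by apply: ler_sum => i _; rewrite normrM ler_pM // normrX ger0_norm.
by rewrite -big_distrr /= mulrC ler_wpM2r.
Qed.

(* If c_N is the first nonzero coefficient, then along the points t0 q with
   q -> 0 the tail is O(q ^ (N + 1)), which c_N (t0 q) ^ N is not. *)
Lemma power_series_eq0 (K : numFieldType) (c : nat -> K) :
  (\forall t \near (0 : K^o)^',
     series (fun n => c n * t ^+ n : K^o) @ \oo --> (0 : K^o)) ->
  forall n, c n = 0.
Proof.
move=> /near_punctured0P[e e0 h] N.
have t00 : e / 2 != 0 by rewrite mulf_neq0 ?gt_eqF // invr_gt0 ltr0n.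
pose t0 := e / 2; pose a n := c n * t0 ^+ n.
have t0e : `|t0| < e.
  by rewrite gtr0_norm ?divr_gt0 // ltr_pdivrMr // ltr_pMr // ltr1n.
have [M M0 aM] : exists2 M : K, 0 < M & forall n, `|a n| <= M.
  have /cvgP /cvg_series_cvg_0 /cvgP /cvg_seq_bounded := h t0 t00 t0e.
  by move=> /pinfty_ex_gt0[M M0 hM]; exists M => // n; apply: hM.
suff : a N = 0.
  by move/eqP; rewrite mulf_eq0 expf_eq0 (negPf t00) andbF orbF => /eqP.
elim/ltn_ind: N => N IH.
(* The constant is 3 = 1 + 2: the partial sum is within [M * q ^+ N.+1] of its limit 0, the tail is
   at most [2 * M * q ^+ N.+1], and [q ^+ N] is divided out. *)
have key q : 0 < q -> q <= 2^-1 -> `|a N| <= 3 * M * q.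
  move=> q0 q2.
  have q1 : `|q| <= 1.
    by rewrite gtr0_norm // (le_trans q2) // invf_le1 ?ltr0n // ler1n.
  have tq0 : t0 * q != 0 by rewrite mulf_neq0 // gt_eqF.
  have tqe : `|t0 * q| < e.
    by apply: le_lt_trans t0e; rewrite normrM ler_piMr.
  have eps0 : 0 < M * q ^+ N.+1 by rewrite mulr_gt0 // exprn_gt0.
  have /cvgrPdist_le/(_ _ eps0)[n _ hn] := h _ tq0 tqe.
  (* [N.+1 + n] terms reach past the threshold [n] and split into the vanishing terms below [N], the
     term [N], and a tail of [n] terms. *)
  have /hn : (n <= N.+1 + n)%N by rewrite leq_addl.
  rewrite sub0r normrN /series /= big_mkord big_split_ord /= big_ord_recr /=.
  have E i : c i * (t0 * q) ^+ i = a i * q ^+ i by rewrite exprMn mulrA.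
  rewrite big1 ?add0r => [|i _]; last by rewrite E IH ?mul0r.
  rewrite E; under eq_bigr do rewrite E addSnnS exprD mulrCA.
  under eq_bigr do rewrite addnS exprS mulrCA.
  set T := (X in _ + X).
  have -> : T = q ^+ N.+1 * \sum_(i < n) a (N + i.+1)%N * q ^+ i.
    rewrite /T exprS -mulrA big_distrr /= big_distrr /=.
    apply: eq_bigr => i _; rewrite addnS; ring.
  have := @norm_sum_geometric_le K (fun i => a (N + i.+1)%N) M q
            (fun i => aM _) (ltW q0) q2 n.
  set S := \sum_(_ < _) _ => hS hle.
  have : `|a N * q ^+ N| <= M * q ^+ N.+1 + q ^+ N.+1 * (2 * M).
    rewrite -[a N * _](addrK (q ^+ N.+1 * S)).
    apply: le_trans (ler_normB _ _) _; apply: lerD => //.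
    by rewrite normrM normrX gtr0_norm // ler_pM2l // exprn_gt0.
  rewrite normrM normrX (gtr0_norm q0).
  rewrite (_ : _ + _ = 3 * M * q * q ^+ N); last by rewrite exprS; ring.
  by rewrite ler_pM2r // exprn_gt0.
apply/eqP; rewrite -normr_le0; apply/negPn/negP => aN.
have {aN} aN : 0 < `|a N| by rewrite normr_gt0 -normr_eq0 eq_le normr_ge0 andbT.
have M6 : 0 < 6 * M by rewrite mulr_gt0.
(* For this [q] the bound [3 * M * q] is half of [|a N|], a contradiction; [|a N| <= M] makes [q]
   small enough. *)
have := key (`|a N| / (6 * M)); rewrite divr_gt0 // => /(_ isT).
rewrite (_ : 3 * M * _ = `|a N| / 2); last first.
  by field; rewrite gt_eqF.
have -> : `|a N| / (6 * M) <= 2^-1.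
  rewrite ler_pdivrMr // (_ : 2^-1 * _ = 3 * M); last by field.
  apply: (le_trans (aM N)); rewrite ler_peMl // ?ltW //.
  by rewrite ltr1n.
move=> /(_ isT); rewrite ler_pdivlMr // ger_pMr //.
by rewrite lern1.
Qed.

(** The difference of the two series is a power series with coefficients [(a n - b n) / n!] and sum
    0 near 0, so [power_series_eq0] applies. *)
Lemma taylor_at0_inj (R : realType) (f g : R[i] -> R[i]) (a b : nat -> R[i]) :
  taylor_at0 f a -> taylor_at0 g b ->
  (\forall t \near (0 : R[i]^o)^', f t = g t) -> a =1 b.
Proof.
move=> fa gb fg n; apply/eqP; rewrite -subr_eq0; apply/eqP.
have fact0 : (n`!%:R : R[i]) != 0 by rewrite pnatr_eq0 -lt0n fact_gt0.
suff /(_ n) /eqP : forall n, (a n - b n) / n`!%:R = 0.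
  by rewrite mulf_eq0 invr_eq0 (negPf fact0) orbF => /eqP.
apply: power_series_eq0; near=> t.
have <- : f t - g t = 0 by rewrite (near fg t) // subrr.
rewrite (_ : series _ = series (fun n => a n * t ^+ n / n`!%:R : R[i]^o) -
                        series (fun n => b n * t ^+ n / n`!%:R : R[i]^o)).
  by apply: cvgB; [exact: (near fa t)|exact: (near gb t)].
apply/funext => j; rewrite /series /= !fctE -sumrB; apply: eq_bigr => i _.
by ring.
Unshelve. all: by end_near. Qed.

(** * Operations on Taylor expansions *)

Lemma taylor_at0_scale (R : realType) (f : R[i] -> R[i]) a (c : R[i]) :
  c != 0 -> taylor_at0 f a ->
  taylor_at0 (fun t => f (c * t)) (fun n => c ^+ n * a n).
Proof.
move=> c0 /(near_punctured0_scale _ _ _ c0); apply: filterS => t.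
rewrite (_ : series _ = series (fun n => c ^+ n * a n * t ^+ n / n`!%:R)) //.
by apply/funext => n; apply: eq_bigr => i _; rewrite exprMn; ring.
Qed.

Lemma taylor_at0Z (R : realType) (f : R[i] -> R[i]) a (c : R[i]) :
  taylor_at0 f a -> taylor_at0 (fun t => c * f t) (fun n => c * a n).
Proof.
apply: filterS => t h.
rewrite (_ : series _ =
  (fun n => c *: series (fun n => a n * t ^+ n / n`!%:R : R[i]^o) n)).
  exact: (cvgZl_tmp h).
apply/funext => n; rewrite /series /= scaler_sumr; apply: eq_bigr => i _.
by rewrite /GRing.scale /=; ring.
Qed.

Lemma taylor_at0_sum (R : realType) (I : finType)
    (f : I -> R[i] -> R[i]) (a : I -> nat -> R[i]) :
  (forall i, taylor_at0 (f i) (a i)) ->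
  taylor_at0 (fun t => \sum_i f i t) (fun n => \sum_i a i n).
Proof.
move=> fa; elim: (index_enum I) => [|i s IH].
  apply: nearW => t; rewrite big_nil.
  rewrite (_ : series _ = fun=> 0); first exact: cvg_cst.
  by apply/funext => n; rewrite /series /= big1 // => j _; rewrite big_nil !mul0r.
apply: filterS2 (fa i) IH => t h1 h2; rewrite big_cons.
rewrite (_ : series _ = series (fun n => a i n * t ^+ n / n`!%:R : R[i]^o) +
   series (fun n => (\sum_(j <- s) a j n) * t ^+ n / n`!%:R : R[i]^o)).
  exact: cvgD.
apply/funext => n; rewrite /series /= !fctE -big_split; apply: eq_bigr => j _ /=.
by rewrite big_cons; ring.
Qed.

(** Shifting the series by [r] changes its factorial normalization; this is the origin of
    [(l + r)! / l!] in the second identity. *)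
Lemma taylor_at0_mulXn (R : realType) (f : R[i] -> R[i]) a r :
  taylor_at0 f a ->
  taylor_at0 (fun t => t ^+ r * f t)
    (fun n => if (n < r)%N then 0 else n`!%:R / (n - r)`!%:R * a (n - r)%N).
Proof.
(* The partial sum with [n + r] terms is [t ^+ r] times the [n]-term partial sum for [f]. *)
apply: filterS => t h; rewrite -(cvg_shiftn r) /=.
rewrite (_ : (fun _ => _) = (fun n =>
    t ^+ r *: series (fun n => a n * t ^+ n / n`!%:R : R[i]^o) n)).
  exact: (cvgZl_tmp h).
apply/funext => n; rewrite /series /= !big_mkord addnC big_split_ord /=.
rewrite big1 ?add0r => [|i _]; last by rewrite ltn_ord !mul0r.
rewrite scaler_sumr; apply: eq_bigr => i _.
rewrite ltnNge leq_addr /= addKn exprD /GRing.scale /=.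
by field; rewrite !pnatr_eq0 -!lt0n !fact_gt0.
Qed.

(** * The complex exponential *)

Lemma expC0 (R : realType) : expC (0 : R[i]) = 1.
Proof. by rewrite /expC /= expR0 cos0 sin0 mul1r. Qed.

Lemma expCD (R : realType) (a b : R[i]) : expC (a + b) = expC a * expC b.
Proof.
case: a b => [a1 a2] [b1 b2]; rewrite /expC /= expRD cosD sinD.
by apply/eqP; rewrite eq_complex /=; apply/andP; split; apply/eqP; ring.
Qed.

Lemma expCMn (R : realType) (n : nat) (a : R[i]) :
  expC (n%:R * a) = expC a ^+ n.
Proof.
elim: n => [|n IH]; first by rewrite mul0r expC0.
by rewrite -natr1 mulrDl mul1r expCD IH exprSr.
Qed.

(** The imaginary part gives [sin b = 0], and [|b| < 1 < pi] forces [b = 0]; the real part then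
    reads [expR a = 1]. *)
Lemma expC_eq1 (R : realType) (t : R[i]) : `|t| < 1 -> expC t = 1 -> t = 0.
Proof.
case: t => a b; rewrite normc_def /= ltcR => ab [].
rewrite !mul0r subr0 addr0 => Ecos Esin.
have {ab} ab : a ^+ 2 + b ^+ 2 < 1.
  rewrite -(@ltr_sqrt _ _ 1) ?ltr01 // sqrtr1 //.
have b1 : `|b| < 1.
  rewrite -(@ltr_pXn2r _ 2) ?nnegrE // expr1n real_normK ?num_real //.
  by apply: le_lt_trans ab; rewrite lerDr sqr_ge0.
have sb : sin b = 0.
  by move/eqP: Esin; rewrite mulf_eq0 gt_eqF ?expR_gt0 //= => /eqP.
have pi1 : (1 : R) < pi by rewrite (lt_le_trans _ (pi_ge2 R)) // ltr1n.
have b0 : b = 0.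
  have [b0|b0|//] := ltgtP b 0.
    have : 0 < sin (- b).
      apply: sin_gt0_pi; rewrite oppr_gt0 b0 /=.
      by rewrite -ltr0_norm // (lt_trans b1).
    by rewrite sinN sb oppr0 ltxx.
  have : 0 < sin b.
    by apply: sin_gt0_pi; rewrite b0 -(gtr0_norm b0) (lt_trans b1).
  by rewrite sb ltxx.
move: Ecos; rewrite b0 cos0 mulr1 -expR0 => /expR_inj ->.
by [].
Qed.

(* Two solutions of [b * expC t = 1] differ by a zero of [expC - 1], so at most
   one of them lies in the disc of radius 1/2. *)
Lemma near_mul_expC_neq1 (R : realType) (b : R[i]) :
  \forall t \near (0 : R[i]^o)^', b * expC t != 1.
Proof.
have [[t1 [t10 t11 bt1]]|h] :=
    pselect (exists t, [/\ t != 0, `|t| < 2^-1 & b * expC t = 1]); last first.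
  apply/near_punctured0P; exists 2^-1 => [|t t0 t2]; first by rewrite invr_gt0.
  by apply/eqP => bt; apply: h; exists t.
(* This radius excludes [t1] itself, while any solution inside it would be within distance 1 of
   [t1]. *)
apply/near_punctured0P; exists `|t1| => [|t t0 tt1]; first by rewrite normr_gt0.
apply/eqP => bt.
have tE : t = t - t1 + t1 by rewrite subrK.
have et : expC (t - t1) = 1.
  have b1 : b * expC t1 != 0 by rewrite bt1 oner_neq0.
  by apply: (mulfI b1); rewrite mulr1 -mulrA [_ * expC (_ - _)]mulrC -expCD subrK bt.
have dist : `|t - t1| < 1.
  apply: le_lt_trans (ler_normB _ _) _.
  rewrite (_ : 1 = 2^-1 + 2^-1); last by field.
  by apply: ltrD => //; apply: lt_trans t11.
have : t = t1 by apply/eqP; rewrite -subr_eq0 (expC_eq1 _ _ dist et).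
by move=> tt; rewrite tt ltxx in tt1.
Qed.

(** * Multiple sums of generating functions *)

Lemma polyM_taylor (R : realType) (r k : nat) (beta : 'I_r -> R[i]) (x : R[i]) :
  analytic_at0 (genM k beta x) ->
  taylor_at0 (genM k beta x) (fun n => polyM k beta n x).
Proof. exact: xgetPex. Qed.

(** Each weight [alpha i ^+ (m * s i)] joins the factor [expC t ^+ (m * s i)] of the shifted
    exponential, leaving powers of [z i ^+ m]. The multiple sum then factors into [r] geometric
    sums, of ratio different from 1 by hypothesis. *)
Lemma sum_genM (R : realType) (k r n m : nat) (alpha : 'I_r -> R[i])
    (x t : R[i]) :
  (0 < n)%N -> (forall i, alpha i ^+ m * expC (m%:R * t) != 1) ->
  \sum_(s : {ffun 'I_r -> 'I_n})
     (\prod_(i < r) alpha i ^+ (m * s i)) *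
     genM k (fun i => alpha i ^+ n)
       (x / n%:R + (\sum_(i < r) s i)%N%:R * m%:R / n%:R) (n%:R * t) =
  (n%:R * t) ^+ (r * k) * 2 ^ (r%:Z * (1 - k%:Z)) *
  (expC (x * t) *
   \prod_(i < r) (((alpha i * expC t) ^+ (n * m) - 1) /
     (((alpha i * expC t) ^+ n - 1) * ((alpha i * expC t) ^+ m - 1)))).
Proof.
move=> n0 am.
have nn0 : (n%:R : R[i]) != 0 by rewrite pnatr_eq0 -lt0n.
pose z i := alpha i * expC t.
have zE i j : alpha i ^+ j * expC (j%:R * t) = z i ^+ j.
  by rewrite expCMn -exprMn.
transitivity (\sum_(s : {ffun 'I_r -> 'I_n})
   (n%:R * t) ^+ (r * k) * 2 ^ (r%:Z * (1 - k%:Z)) * (expC (x * t) *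
    \prod_(i < r) ((z i ^+ m) ^+ s i / (z i ^+ n - 1)))).
  apply: eq_bigr => s _; rewrite /genM.
  have -> : (x / n%:R + (\sum_(i < r) s i)%N%:R * m%:R / n%:R) * (n%:R * t) =
      x * t + (\sum_(i < r) m * s i)%N%:R * t.
    by rewrite -big_distrr natrM /=; field.
  rewrite expCD expCMn -prodrXr big_split /= prodfV.
  have -> : \prod_(i < r) (z i ^+ m) ^+ s i =
     (\prod_(i < r) alpha i ^+ (m * s i)) * \prod_(i < r) expC t ^+ (m * s i).
    by rewrite -big_split; apply: eq_bigr => i _ /=; rewrite -exprM exprMn.
  under [\prod_(i < r) (_ - 1)]eq_bigr do rewrite zE.
  by rewrite !mulrA; congr (_ / _); ring.
rewrite -!big_distrr /=; congr (_ * (_ * _)).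
(* A sum over all functions [s] of a product over [i] is a product of sums over the values of
   [s i]. *)
rewrite -(bigA_distr_bigA (fun i (j : 'I_n) => (z i ^+ m) ^+ j / (z i ^+ n - 1))).
apply: eq_bigr => i _; rewrite -big_distrl /= -/(z i).
have zm : z i ^+ m - 1 != 0 by rewrite subr_eq0 -zE am.
rewrite [in RHS]mulnC exprM (subrX1 (z i ^+ m) n) [in RHS]invfM.
by rewrite [_^-1 * (z i ^+ m - 1)^-1]mulrC mulrACA divff // mul1r.
Qed.

Lemma taylor_at0_sum_genM (R : realType) (k r n m : nat) (alpha : 'I_r -> R[i])
    (x : R[i]) :
  (0 < n)%N ->
  (forall y, analytic_at0 (genM k (fun i => alpha i ^+ n) y)) ->
  let y (s : {ffun 'I_r -> 'I_n}) := x / n%:R + (\sum_(i < r) s i)%N%:R * m%:R / n%:R in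
  taylor_at0
    (fun t => \sum_(s : {ffun 'I_r -> 'I_n})
       (\prod_(i < r) alpha i ^+ (m * s i)) *
       genM k (fun i => alpha i ^+ n) (y s) (n%:R * t))
    (fun l => n%:R ^+ l * \sum_(s : {ffun 'I_r -> 'I_n})
       (\prod_(i < r) alpha i ^+ (m * s i)) *
       polyM k (fun i => alpha i ^+ n) l (y s)).
Proof.
move=> n0 an y.
rewrite (_ : (fun l => _) = (fun l => \sum_(s : {ffun 'I_r -> 'I_n})
    (\prod_(i < r) alpha i ^+ (m * s i)) *
    (n%:R ^+ l * polyM k (fun i => alpha i ^+ n) l (y s)))); last first.
  apply/funext => l; rewrite big_distrr /=.
  by apply: eq_bigr => s _; rewrite mulrCA.
apply: taylor_at0_sum => s; apply: taylor_at0Z; apply: taylor_at0_scale.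
  by rewrite pnatr_eq0 -lt0n.
exact: polyM_taylor.
Qed.

(** * Comparison of coefficients *)

Theorem theorem3p6 (R : realType) (k r n m : nat)
    (hk : (0 < k)%N) (hr : (0 < r)%N) (hn : (0 < n)%N) (hm : (0 < m)%N)
    (alpha : 'I_r -> R[i]) :
  (forall y : R[i], analytic_at0 (genM k (fun i => alpha i ^+ n) y)) ->
  ((forall y : R[i], analytic_at0 (genM k (fun i => alpha i ^+ m) y)) ->
   forall (x : R) (l : nat),
     n%:R ^+ l *
       \sum_(s : {ffun 'I_r -> 'I_n})
         (\prod_(i < r) alpha i ^+ (m * s i)) *
         polyM k (fun i => alpha i ^+ n) l
           (x%:C / n%:R + (\sum_(i < r) s i)%N%:R * m%:R / n%:R)
     = m%:R ^ (- (r%:Z * k%:Z) + l%:Z) * n%:R ^+ (r * k) *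
       \sum_(p : {ffun 'I_r -> 'I_m})
         (\prod_(i < r) alpha i ^+ (n * p i)) *
         polyM k (fun i => alpha i ^+ m) l
           (x%:C / m%:R + (\sum_(i < r) p i)%N%:R * n%:R / m%:R))
  /\
  ((forall y : R[i], analytic_at0 (genM k.-1 (fun i => alpha i ^+ m) y)) ->
   forall (x : R) (l : nat),
     n%:R ^+ (l + r) *
       \sum_(s : {ffun 'I_r -> 'I_n})
         (\prod_(i < r) alpha i ^+ (m * s i)) *
         polyM k (fun i => alpha i ^+ n) (l + r)
           (x%:C / n%:R + (\sum_(i < r) s i)%N%:R * m%:R / n%:R)
     = ((l + r)`!)%:R / (l`!)%:R *
       (m%:R ^ (- (r%:Z * (k%:Z - 1)) + l%:Z) * n%:R ^+ (r * k) / 2 ^+ r) *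
       \sum_(p : {ffun 'I_r -> 'I_m})
         (\prod_(i < r) alpha i ^+ (n * p i)) *
         polyM k.-1 (fun i => alpha i ^+ m) l
           (x%:C / m%:R + (\sum_(i < r) p i)%N%:R * n%:R / m%:R)).
Proof.
have n0 : (n%:R : R[i]) != 0 by rewrite pnatr_eq0 -lt0n.
have m0 : (m%:R : R[i]) != 0 by rewrite pnatr_eq0 -lt0n.
have near_neq1 j : (j%:R : R[i]) != 0 ->
    \forall t \near (0 : R[i]^o)^', forall i, alpha i ^+ j * expC (j%:R * t) != 1.
  move=> j0; apply: filter_forall => i.
  exact: (near_punctured0_scale _ _ (fun t => alpha i ^+ j * expC t != 1) j0
    (near_mul_expC_neq1 _ _)).
move=> an; split=> am x l;
  have tn := taylor_at0_sum_genM _ _ _ _ m _ x%:C hn an;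
  have tm := taylor_at0_sum_genM _ _ _ _ n _ x%:C hm am.
(* In the closed form only [(n t) ^ (r k)] is not symmetric in [n] and [m]; hence the constant
   [(n / m) ^ (r k)]. *)
- rewrite (taylor_at0_inj _ _ _ _ _ tn
    (taylor_at0Z _ _ _ ((n%:R / m%:R) ^+ (r * k)) tm) _ l) /=.
    by rewrite expfzDr // -PoszM -exprnN -exprnP expr_div_n; ring.
  near=> t.
  (* [tam] serves the geometric sums over [s], of ratio [z i ^+ m], and [tan] those over [p], of
     ratio [z i ^+ n]. *)
  have tan : forall i, alpha i ^+ n * expC (n%:R * t) != 1.
    by near: t; exact: near_neq1.
  have tam : forall i, alpha i ^+ m * expC (m%:R * t) != 1.
    by near: t; exact: near_neq1.
  rewrite !sum_genM //.
  rewrite [(m * n)%N]mulnC.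
  under [in RHS]eq_bigr do rewrite [((_ ^+ m) - 1) * _]mulrC.
  have -> : (n%:R * t) ^+ (r * k) = (n%:R / m%:R) ^+ (r * k) * (m%:R * t) ^+ (r * k).
    by rewrite -exprMn mulrA divfK.
  by rewrite !mulrA.
(* Lowering [k] by one leaves [t ^+ r] and [2 ^- r] over; the former shifts coefficient [l] to
   [l + r]. *)
- rewrite (taylor_at0_inj _ _ _ _ _ tn
    (taylor_at0Z _ _ _ (n%:R ^+ (r * k) / m%:R ^+ (r * k.-1) / 2 ^+ r)
      (taylor_at0_mulXn _ _ _ r tm)) _ (l + r)%N) /=.
    rewrite ltnNge leq_addl /= addnK expfzDr //.
    (* The truncated predecessor is the integer [k - 1] because [k] is positive. *)
    have -> : k%:Z - 1 = k.-1%:Z by rewrite -{1}(prednK hk) -addn1 PoszD addrK.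
    by rewrite -PoszM -exprnN -exprnP; ring.
  near=> t.
  have tan : forall i, alpha i ^+ n * expC (n%:R * t) != 1.
    by near: t; exact: near_neq1.
  have tam : forall i, alpha i ^+ m * expC (m%:R * t) != 1.
    by near: t; exact: near_neq1.
  rewrite !sum_genM //.
  rewrite [(m * n)%N]mulnC.
  under [in RHS]eq_bigr do rewrite [((_ ^+ m) - 1) * _]mulrC.
  have -> : (n%:R * t) ^+ (r * k) =
      n%:R ^+ (r * k) / m%:R ^+ (r * k.-1) * t ^+ r * (m%:R * t) ^+ (r * k.-1).
    have -> : (r * k = r + r * k.-1)%N by rewrite -mulnS prednK.
    by rewrite !exprMn [t ^+ (_ + _)]exprD; field; rewrite expf_neq0.
  have -> : 2 ^ (r%:Z * (1 - k%:Z)) = 2 ^ (r%:Z * (1 - k.-1%:Z)) / 2 ^+ r :> R[i].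
    rewrite exprnN -expfzDr ?pnatr_eq0 //; congr (_ ^ _).
    by rewrite -{1}(prednK hk) -addn1 PoszD; ring.
  by ring.
Unshelve. all: by end_near. Qed.
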